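(* The 2-category $\mathbf{MonCat}$ of monoidal categories, monoidal functors, and monoidal natural transformations can be identified, via $\mathscr V\mapsto\Sigma\mathscr V$, with the full sub-2-category of $\mathbf{Bicat}_2$ consisting of the one-object bicategories. That is, $\mathscr V\mapsto\Sigma\mathscr V$ is the object part of a 2-functor $\Sigma:\mathbf{MonCat}\to\mathbf{Bicat}_2$ which induces isomorphisms of hom-categories $\mathbf{MonCat}(\mathscr V,\mathscr W)\cong\mathbf{Bicat}_2(\Sigma\mathscr V,\Sigma\mathscr W)$, and every bicategory with exactly one object is, up to renaming its object, of the form $\Sigma\mathscr V$ for a monoidal category $\mathscr V$.
   Context: Monoidal functor means lax monoidal functor: a functor $F:\mathscr V\to\mathscr W$ with coherent, not necessarily invertible, maps $FX\otimes FY\to F(X\otimes Y)$ and $I\to FI$. A monoidal natural transformation is a natural transformation compatible with these maps. For a monoidal category $\mathscr V$, $\Sigma\mathscr V$ denotes the bicategory with a single object $*$, hom-category $\Sigma\mathscr V( *,* )=\mathscr V$, composition given by $\otimes:\mathscr V\times\mathscr V\to\mathscr V$, and identity 1-cell on $*$ given by the unit object $I$. $\mathbf{Bicat}_2$ is the 2-category of bicategories, lax functors, and icons. A lax functor $F:\mathscr A\to\mathscr B$ of bicategories consists of a function on objects, functors $F:\mathscr A(A,B)\to\mathscr B(FA,FB)$, and 2-cells $\varphi_{g,f}:Fg.Ff\to F(gf)$, natural in $f,g$, and $\varphi^0_A:1_{FA}\to F1_A$, satisfying the usual coherence conditions; the constraints need not be invertible. Icon: let $F,G:\mathscr A\to\mathscr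 B$ be lax functors with constraints $(\varphi,\varphi^0)$ and $(\psi,\psi^0)$, such that $FA=GA$ for all objects $A$. An icon $\alpha:F\to G$ consists of, for all objects $A,B$ of $\mathscr A$, a natural transformation $\alpha:F\to G:\mathscr A(A,B)\to\mathscr B(FA,FB)$, with components $\alpha_f:Ff\to Gf$, such that $\psi_{g,f}\circ(\alpha_g.\alpha_f)=\alpha_{gf}\circ\varphi_{g,f}$ for all composable 1-cells $f:A\to B$, $g:B\to C$, and $\alpha_{1_A}\circ\varphi^0_A=\psi^0_A$ for all objects $A$. Lax functors are composed in the usual way. Icons are composed vertically as natural transformations on hom-categories, and whiskering is $(H\alpha K)_f=H(\alpha_{Kf})$. *)

(* Defs.v *)
From Stdlib Require Import FunctionalExtensionality ProofIrrelevance JMeq FinFun.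

Set Implicit Arguments.
Unset Strict Implicit.
Unset Printing Implicit Defensive.

Declare Scope cat_scope.
Delimit Scope cat_scope with cat.
Open Scope cat_scope.

#[local] Obligation Tactic := idtac.

Reserved Notation "g ∘ f" (at level 40, left associativity).
Reserved Notation "x ⊗ y" (at level 38, left associativity).
Reserved Notation "f ⊗₁ g" (at level 38, left associativity).
Reserved Notation "g ⊙ f" (at level 38, left associativity).
Reserved Notation "b ⊙₁ a" (at level 38, left associativity).

Record Category : Type := {
  obj :> Type;
  hom : obj -> obj -> Type;
  idm : forall x, hom x x;
  cmp : forall x y z, hom y z -> hom x y -> hom x z;
  cmp_idl : forall x y (f : hom x y), cmp (idm y) f = f;
  cmp_idr : forall x y (f : hom x y), cmp f (idm x) = f;
  cmp_assoc : forall x y z w (h : hom z w) (g : hom y z) (f : hom x y),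
    cmp (cmp h g) f = cmp h (cmp g f)
}.
Arguments hom {_} _ _.
Arguments idm {_} _.
Arguments cmp {_ _ _ _} _ _.
Notation "g ∘ f" := (cmp g f) : cat_scope.

Definition is_iso (C : Category) (x y : C) (f : hom x y) : Prop :=
  exists g : hom y x, g ∘ f = idm x /\ f ∘ g = idm y.

Record Functor (C D : Category) : Type := {
  fob :> C -> D;
  fmap : forall x y, hom x y -> hom (fob x) (fob y);
  fmap_id : forall x, fmap (idm x) = idm (fob x);
  fmap_cmp : forall x y z (g : hom y z) (f : hom x y),
    fmap (g ∘ f) = fmap g ∘ fmap f
}.
Arguments fmap {_ _} _ {_ _} _.

Record NatTrans (C D : Category) (F G : Functor C D) : Type := {
  nt :> forall x, hom (F x) (G x);
  nt_nat : forall x y (f : hom x y), nt y ∘ fmap F f = fmap G f ∘ nt x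
}.

Definition functor_id (C : Category) : Functor C C :=
  {| fob := fun x => x; fmap := fun _ _ f => f;
     fmap_id := fun _ => eq_refl; fmap_cmp := fun _ _ _ _ _ => eq_refl |}.

Program Definition functor_comp (C D E : Category)
    (G : Functor D E) (F : Functor C D) : Functor C E :=
  {| fob := fun x => G (F x); fmap := fun _ _ f => fmap G (fmap F f) |}.
Next Obligation. intros; cbn; now rewrite !fmap_id. Qed.
Next Obligation. intros; cbn; now rewrite !fmap_cmp. Qed.

Definition is_isomorphism_of_categories (C D : Category) (F : Functor C D) : Prop :=
  exists G : Functor D C,
    functor_comp G F = functor_id C /\ functor_comp F G = functor_id D.

Program Definition prod_cat (C D : Category) : Category :=
  {| obj := (C * D)%type;
     hom := fun x y => (hom (fst x) (fst y) * hom (snd x) (snd y))%type;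
     idm := fun x => (idm (fst x), idm (snd x));
     cmp := fun _ _ _ g f => (fst g ∘ fst f, snd g ∘ snd f) |}.
Next Obligation. intros ? ? ? ? [f g]; cbn; now rewrite !cmp_idl. Qed.
Next Obligation. intros ? ? ? ? [f g]; cbn; now rewrite !cmp_idr. Qed.
Next Obligation. intros; cbn; now rewrite !cmp_assoc. Qed.

Program Definition functor_prod (C C' D D' : Category)
    (F : Functor C D) (G : Functor C' D') : Functor (prod_cat C C') (prod_cat D D') :=
  {| fob := fun x => (F (fst x), G (snd x));
     fmap := fun _ _ f => (fmap F (fst f), fmap G (snd f)) |}.
Next Obligation. intros; cbn; now rewrite !fmap_id. Qed.
Next Obligation. intros; cbn; now rewrite !fmap_cmp. Qed.

Program Definition prod_assoc (C D E : Category) :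
    Functor (prod_cat (prod_cat C D) E) (prod_cat C (prod_cat D E)) :=
  {| fob := fun x => (fst (fst x), (snd (fst x), snd x));
     fmap := fun _ _ f => (fst (fst f), (snd (fst f), snd f)) |}.
Solve All Obligations with reflexivity.

Program Definition pair_left (C D : Category) (c : C) : Functor D (prod_cat C D) :=
  {| fob := fun x => (c, x); fmap := fun _ _ f => (idm c, f) |}.
Solve All Obligations with intros; cbn; now rewrite ?cmp_idl.

Program Definition pair_right (C D : Category) (d : D) : Functor C (prod_cat C D) :=
  {| fob := fun x => (x, d); fmap := fun _ _ f => (f, idm d) |}.
Solve All Obligations with intros; cbn; now rewrite ?cmp_idl.

(** Strict 2-categories and 2-functors are Cat-enriched: each axiom is an equality
    of functors between hom-categories, hence holds on 1-cells and on 2-cells. *)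

Record TwoCategory : Type := {
  ob0 :> Type;
  hcat : ob0 -> ob0 -> Category;
  id1 : forall A, hcat A A;
  comp1 : forall A B C, Functor (prod_cat (hcat B C) (hcat A B)) (hcat A C);
  comp1_idl : forall A B,
    functor_comp (comp1 A B B) (pair_left _ (id1 B)) = functor_id (hcat A B);
  comp1_idr : forall A B,
    functor_comp (comp1 A A B) (pair_right _ (id1 A)) = functor_id (hcat A B);
  comp1_assoc : forall A B C D,
    functor_comp (comp1 A B D)
      (functor_prod (comp1 B C D) (functor_id (hcat A B))) =
    functor_comp (functor_comp (comp1 A C D)
      (functor_prod (functor_id (hcat C D)) (comp1 A B C)))
      (prod_assoc (hcat C D) (hcat B C) (hcat A B))
}.
Arguments hcat {_} _ _.
Arguments id1 {_} _.
Arguments comp1 {_} _ _ _.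

Record TwoFunctorOver (K L : TwoCategory) (F0 : K -> L) : Type := {
  tf_hom : forall A B, Functor (hcat A B) (hcat (F0 A) (F0 B));
  tf_id : forall A, tf_hom A A (id1 A) = id1 (F0 A);
  tf_comp : forall A B C,
    functor_comp (tf_hom A C) (comp1 A B C) =
    functor_comp (comp1 (F0 A) (F0 B) (F0 C))
      (functor_prod (tf_hom B C) (tf_hom A B))
}.
Arguments tf_hom {_ _ _} _ _ _.

Record MonoidalCategory : Type := {
  mcat :> Category;
  tensor : Functor (prod_cat mcat mcat) mcat;
  munit : mcat;
  massoc : forall x y z : mcat,
    hom (tensor (tensor (x, y), z)) (tensor (x, tensor (y, z)));
  mlunit : forall x : mcat, hom (tensor (munit, x)) x;
  mrunit : forall x : mcat, hom (tensor (x, munit)) x;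
  massoc_iso : forall x y z, is_iso (massoc x y z);
  mlunit_iso : forall x, is_iso (mlunit x);
  mrunit_iso : forall x, is_iso (mrunit x);
  massoc_nat : forall (x x' y y' z z' : mcat)
      (f : hom x x') (g : hom y y') (h : hom z z'),
    massoc x' y' z' ∘
      @fmap _ _ tensor (_, _) (_, _) (@fmap _ _ tensor (_, _) (_, _) (f, g), h) =
    @fmap _ _ tensor (_, _) (_, _) (f, @fmap _ _ tensor (_, _) (_, _) (g, h)) ∘
      massoc x y z;
  mlunit_nat : forall (x y : mcat) (f : hom x y),
    mlunit y ∘ @fmap _ _ tensor (_, _) (_, _) (idm munit, f) = f ∘ mlunit x;
  mrunit_nat : forall (x y : mcat) (f : hom x y),
    mrunit y ∘ @fmap _ _ tensor (_, _) (_, _) (f, idm munit) = f ∘ mrunit x;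
  mpentagon : forall w x y z : mcat,
    massoc w x (tensor (y, z)) ∘ massoc (tensor (w, x)) y z =
    @fmap _ _ tensor (_, _) (_, _) (idm w, massoc x y z) ∘
      massoc w (tensor (x, y)) z ∘
      @fmap _ _ tensor (_, _) (_, _) (massoc w x y, idm z);
  mtriangle : forall x y : mcat,
    @fmap _ _ tensor (_, _) (_, _) (idm x, mlunit y) ∘ massoc x munit y =
    @fmap _ _ tensor (_, _) (_, _) (mrunit x, idm y)
}.
Arguments munit {_}.
Arguments massoc {_} _ _ _.
Arguments mlunit {_} _.
Arguments mrunit {_} _.

Notation "x ⊗ y" := (fob (tensor _) (x, y)) : cat_scope.
Notation "f ⊗₁ g" := (@fmap _ _ (tensor _) (_, _) (_, _) (f, g)) : cat_scope.

Record MonoidalFunctor (V W : MonoidalCategory) : Type := {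
  mfun :> Functor V W;
  mmu : forall x y : V, hom (mfun x ⊗ mfun y) (mfun (x ⊗ y));
  meps : hom munit (mfun munit);
  mmu_nat : forall (x x' y y' : V) (f : hom x x') (g : hom y y'),
    mmu x' y' ∘ (fmap mfun f ⊗₁ fmap mfun g) = fmap mfun (f ⊗₁ g) ∘ mmu x y;
  mmu_assoc : forall x y z : V,
    fmap mfun (massoc x y z) ∘ mmu (x ⊗ y) z ∘ (mmu x y ⊗₁ idm (mfun z)) =
    mmu x (y ⊗ z) ∘ (idm (mfun x) ⊗₁ mmu y z) ∘ massoc (mfun x) (mfun y) (mfun z);
  mmu_lunit : forall x : V,
    fmap mfun (mlunit x) ∘ mmu munit x ∘ (meps ⊗₁ idm (mfun x)) = mlunit (mfun x);
  mmu_runit : forall x : V,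
    fmap mfun (mrunit x) ∘ mmu x munit ∘ (idm (mfun x) ⊗₁ meps) = mrunit (mfun x)
}.
Arguments mmu {_ _} _ _ _.
Arguments meps {_ _} _.

Record MonoidalNatTrans (V W : MonoidalCategory) (F G : MonoidalFunctor V W) : Type := {
  mnt :> NatTrans F G;
  mnt_mu : forall x y : V, mmu G x y ∘ (mnt x ⊗₁ mnt y) = mnt (x ⊗ y) ∘ mmu F x y;
  mnt_eps : mnt munit ∘ meps F = meps G
}.

Record Bicategory : Type := {
  bob :> Type;
  bhom : bob -> bob -> Category;
  bid : forall A, bhom A A;
  bcomp : forall A B C, Functor (prod_cat (bhom B C) (bhom A B)) (bhom A C);
  bassoc : forall A B C D (h : bhom C D) (g : bhom B C) (f : bhom A B),
    hom (bcomp A B D (bcomp B C D (h, g), f)) (bcomp A C D (h, bcomp A B C (g, f)));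
  blunit : forall A B (f : bhom A B), hom (bcomp A B B (bid B, f)) f;
  brunit : forall A B (f : bhom A B), hom (bcomp A A B (f, bid A)) f;
  bassoc_iso : forall A B C D (h : bhom C D) (g : bhom B C) (f : bhom A B),
    is_iso (bassoc h g f);
  blunit_iso : forall A B (f : bhom A B), is_iso (blunit f);
  brunit_iso : forall A B (f : bhom A B), is_iso (brunit f);
  bassoc_nat : forall A B C D (h h' : bhom C D) (g g' : bhom B C) (f f' : bhom A B)
      (c : hom h h') (b : hom g g') (a : hom f f'),
    bassoc h' g' f' ∘
      @fmap _ _ (bcomp A B D) (_, _) (_, _)
        (@fmap _ _ (bcomp B C D) (_, _) (_, _) (c, b), a) =
    @fmap _ _ (bcomp A C D) (_, _) (_, _)
        (c, @fmap _ _ (bcomp A B C) (_, _) (_, _) (b, a)) ∘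
      bassoc h g f;
  blunit_nat : forall A B (f g : bhom A B) (a : hom f g),
    blunit g ∘ @fmap _ _ (bcomp A B B) (_, _) (_, _) (idm (bid B), a) = a ∘ blunit f;
  brunit_nat : forall A B (f g : bhom A B) (a : hom f g),
    brunit g ∘ @fmap _ _ (bcomp A A B) (_, _) (_, _) (a, idm (bid A)) = a ∘ brunit f;
  bpentagon : forall A B C D E
      (k : bhom D E) (h : bhom C D) (g : bhom B C) (f : bhom A B),
    bassoc k h (bcomp A B C (g, f)) ∘ bassoc (bcomp C D E (k, h)) g f =
    @fmap _ _ (bcomp A D E) (_, _) (_, _) (idm k, bassoc h g f) ∘
      bassoc k (bcomp B C D (h, g)) f ∘
      @fmap _ _ (bcomp A B E) (_, _) (_, _) (bassoc k h g, idm f);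
  btriangle : forall A B C (g : bhom B C) (f : bhom A B),
    @fmap _ _ (bcomp A B C) (_, _) (_, _) (idm g, blunit f) ∘ bassoc g (bid B) f =
    @fmap _ _ (bcomp A B C) (_, _) (_, _) (brunit g, idm f)
}.
Arguments bhom {_} _ _.
Arguments bid {_} _.
Arguments bcomp {_} _ _ _.
Arguments bassoc {_ _ _ _ _} _ _ _.
Arguments blunit {_ _ _} _.
Arguments brunit {_ _ _} _.

Notation "g ⊙ f" := (fob (bcomp _ _ _) (g, f)) : cat_scope.
Notation "b ⊙₁ a" := (@fmap _ _ (bcomp _ _ _) (_, _) (_, _) (b, a)) : cat_scope.

Record LaxFunctorOver (A B : Bicategory) (F0 : A -> B) : Type := {
  lfun : forall X Y, Functor (bhom X Y) (bhom (F0 X) (F0 Y));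
  lphi : forall X Y Z (g : bhom Y Z) (f : bhom X Y),
    hom (lfun Y Z g ⊙ lfun X Y f) (lfun X Z (g ⊙ f));
  lphi0 : forall X, hom (bid (F0 X)) (lfun X X (bid X));
  lphi_nat : forall X Y Z (g g' : bhom Y Z) (f f' : bhom X Y)
      (b : hom g g') (a : hom f f'),
    lphi g' f' ∘ (fmap (lfun Y Z) b ⊙₁ fmap (lfun X Y) a) =
    fmap (lfun X Z) (b ⊙₁ a) ∘ lphi g f;
  lphi_assoc : forall X Y Z T (h : bhom Z T) (g : bhom Y Z) (f : bhom X Y),
    fmap (lfun X T) (bassoc h g f) ∘ lphi (h ⊙ g) f ∘
      (lphi h g ⊙₁ idm (lfun X Y f)) =
    lphi h (g ⊙ f) ∘ (idm (lfun Z T h) ⊙₁ lphi g f) ∘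
      bassoc (lfun Z T h) (lfun Y Z g) (lfun X Y f);
  lphi_lunit : forall X Y (f : bhom X Y),
    fmap (lfun X Y) (blunit f) ∘ lphi (bid Y) f ∘ (lphi0 Y ⊙₁ idm (lfun X Y f)) =
    blunit (lfun X Y f);
  lphi_runit : forall X Y (f : bhom X Y),
    fmap (lfun X Y) (brunit f) ∘ lphi f (bid X) ∘ (idm (lfun X Y f) ⊙₁ lphi0 X) =
    brunit (lfun X Y f)
}.
Arguments lfun {_ _ _} _ _ _.
Arguments lphi {_ _ _} _ {_ _ _} _ _.
Arguments lphi0 {_ _ _} _ _.

Record LaxFunctor (A B : Bicategory) : Type := {
  lob : A -> B;
  lax :> LaxFunctorOver lob
}.

Record IconOver (A B : Bicategory) (F0 : A -> B) (F G : LaxFunctorOver F0) : Type := {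
  icell : forall X Y, NatTrans (lfun F X Y) (lfun G X Y);
  icell_phi : forall X Y Z (g : bhom Y Z) (f : bhom X Y),
    lphi G g f ∘ (icell Y Z g ⊙₁ icell X Y f) = icell X Z (g ⊙ f) ∘ lphi F g f;
  icell_phi0 : forall X, icell X X (bid X) ∘ lphi0 F X = lphi0 G X
}.
Arguments icell {_ _ _ _ _} _ _ _.

(** [lob F = lob G] amounts, by functional extensionality, to [FA = GA] for all
    [A].  To type the components of the icon, [G] is transported to a lax functor
    with object part [lob F].  Proofs of [lob F = lob G] are unique, so
    [icon_ob] carries no data. *)
Record Icon (A B : Bicategory) (F G : LaxFunctor A B) : Type := {
  icon_ob : lob F = lob G;
  icon_over : IconOver F (eq_rect_r (@LaxFunctorOver A B) (lax G) icon_ob)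
}.

Definition arr (C : Category) (x y : C) (f : hom x y) : {x : C & {y : C & hom x y}} :=
  existT _ x (existT _ y f).

Lemma functor_eq (C D : Category) (F G : Functor C D) :
  (forall x y (f : hom x y), arr (fmap F f) = arr (fmap G f)) -> F = G.
Proof.
  destruct F as [F0 F1 Fi Fc], G as [G0 G1 Gi Gc]; cbn; intros H.
  assert (F0 = G0) as <-.
  { extensionality x. exact (f_equal (@projT1 _ _) (H x x (idm x))). }
  assert (F1 = G1) as <-.
  { extensionality x; extensionality y; extensionality f.
    specialize (H x y f). unfold arr in H.
    apply inj_pair2 in H. now apply inj_pair2 in H. }
  f_equal; apply proof_irrelevance.
Qed.

Lemma nattrans_eq (C D : Category) (F G : Functor C D) (a b : NatTrans F G) :
  (forall x, a x = b x) -> a = b.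
Proof.
  destruct a as [a ?], b as [b ?]; cbn; intros H.
  assert (a = b) as <- by (extensionality x; apply H).
  f_equal; apply proof_irrelevance.
Qed.

Program Definition nt_id (C D : Category) (F : Functor C D) : NatTrans F F :=
  {| nt := fun x => idm (F x) |}.
Next Obligation. intros; now rewrite cmp_idl, cmp_idr. Qed.

Program Definition nt_vcomp (C D : Category) (F G H : Functor C D)
    (b : NatTrans G H) (a : NatTrans F G) : NatTrans F H :=
  {| nt := fun x => b x ∘ a x |}.
Next Obligation.
  intros; cbn. now rewrite cmp_assoc, nt_nat, <- cmp_assoc, nt_nat, cmp_assoc.
Qed.

(** When [b] or [a] is an identity this is the whiskering [H (a x)], resp. [b (F x)]. *)
Program Definition nt_hcomp (C D E : Category) (F G : Functor C D) (H K : Functor D E)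
    (b : NatTrans H K) (a : NatTrans F G) :
    NatTrans (functor_comp H F) (functor_comp K G) :=
  {| nt := fun x => fmap K (a x) ∘ b (F x) |}.
Next Obligation.
  intros; cbn. rewrite cmp_assoc, nt_nat, <- !cmp_assoc, <- !fmap_cmp.
  now rewrite nt_nat.
Qed.

Lemma fmap2_cmp (C D E : Category) (T : Functor (prod_cat C D) E)
    (x y z : C) (x' y' z' : D)
    (g : hom y z) (f : hom x y) (g' : hom y' z') (f' : hom x' y') :
  @fmap _ _ T (_, _) (_, _) (g ∘ f, g' ∘ f') =
  @fmap _ _ T (_, _) (_, _) (g, g') ∘ @fmap _ _ T (_, _) (_, _) (f, f').
Proof. exact (@fmap_cmp _ _ T (x, x') (y, y') (z, z') (g, g') (f, f')). Qed.

Lemma fmap2_id (C D E : Category) (T : Functor (prod_cat C D) E) (x : C) (y : D) :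
  @fmap _ _ T (x, y) (x, y) (idm x, idm y) = idm (T (x, y)).
Proof. exact (@fmap_id _ _ T (x, y)). Qed.

Lemma fmap2_cmpl (C D E : Category) (T : Functor (prod_cat C D) E)
    (x y z : C) (w : D) (g : hom y z) (f : hom x y) :
  @fmap _ _ T (_, _) (_, _) (g ∘ f, idm w) =
  @fmap _ _ T (_, _) (_, _) (g, idm w) ∘ @fmap _ _ T (_, _) (_, _) (f, idm w).
Proof. now rewrite <- fmap2_cmp, cmp_idl. Qed.

Lemma fmap2_cmpr (C D E : Category) (T : Functor (prod_cat C D) E)
    (x y z : D) (w : C) (g : hom y z) (f : hom x y) :
  @fmap _ _ T (_, _) (_, _) (idm w, g ∘ f) =
  @fmap _ _ T (_, _) (_, _) (idm w, g) ∘ @fmap _ _ T (_, _) (_, _) (idm w, f).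
Proof. now rewrite <- fmap2_cmp, cmp_idl. Qed.

Lemma mon_functor_eq (V W : MonoidalCategory) (F G : MonoidalFunctor V W) :
  mfun F = mfun G ->
  (forall x y, JMeq (mmu F x y) (mmu G x y)) -> JMeq (meps F) (meps G) -> F = G.
Proof.
  destruct F as [F m e ? ? ? ?], G as [G m' e' ? ? ? ?]; cbn.
  intros <- Hm He. apply JMeq_eq in He as <-.
  assert (m = m') as <-
    by (extensionality x; extensionality y; apply JMeq_eq, Hm).
  f_equal; apply proof_irrelevance.
Qed.

Lemma mon_nattrans_eq (V W : MonoidalCategory) (F G : MonoidalFunctor V W)
    (a b : MonoidalNatTrans F G) : (forall x, a x = b x) -> a = b.
Proof.
  destruct a as [a ? ?], b as [b ? ?]; cbn; intros H.
  apply nattrans_eq in H as <-. f_equal; apply proof_irrelevance.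
Qed.

Program Definition mon_functor_id (V : MonoidalCategory) : MonoidalFunctor V V :=
  {| mfun := functor_id V; mmu := fun x y => idm (x ⊗ y); meps := idm munit |}.
Next Obligation. intros; cbn; now rewrite cmp_idl, cmp_idr. Qed.
Next Obligation. intros; cbn; now rewrite !fmap2_id, !cmp_idr, !cmp_idl. Qed.
Next Obligation. intros; cbn; now rewrite !fmap2_id, !cmp_idr. Qed.
Next Obligation. intros; cbn; now rewrite !fmap2_id, !cmp_idr. Qed.

Program Definition mon_functor_comp (U V W : MonoidalCategory)
    (G : MonoidalFunctor V W) (F : MonoidalFunctor U V) : MonoidalFunctor U W :=
  {| mfun := functor_comp G F;
     mmu := fun x y => fmap G (mmu F x y) ∘ mmu G (F x) (F y);
     meps := fmap G (meps F) ∘ meps G |}.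
Next Obligation.
  intros; cbn. rewrite cmp_assoc, mmu_nat, <- !cmp_assoc, <- !fmap_cmp.
  now rewrite mmu_nat.
Qed.
Next Obligation.
  intros; cbn. rewrite fmap2_cmpl, fmap2_cmpr.
  rewrite <- (fmap_id G), !cmp_assoc.
  rewrite <- (cmp_assoc (mmu G (F (x ⊗ y)) (F z))), mmu_nat.
  rewrite <- !cmp_assoc, <- !fmap_cmp, mmu_assoc, !fmap_cmp, !cmp_assoc.
  rewrite <- (cmp_assoc (mmu G (F x) (F (y ⊗ z)))).
  rewrite <- (fmap_id G (F x)), mmu_nat, !cmp_assoc.
  rewrite !fmap_id. rewrite <- (cmp_assoc (mmu G (F x) (F y ⊗ F z))), <- mmu_assoc.
  now rewrite !cmp_assoc.
Qed.
Next Obligation.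
  intros; cbn. rewrite fmap2_cmpl, <- (fmap_id G) at 1. rewrite !cmp_assoc.
  rewrite <- (cmp_assoc (mmu G (F munit) (F x))), mmu_nat.
  rewrite <- !cmp_assoc, <- !fmap_cmp, mmu_lunit. apply mmu_lunit.
Qed.
Next Obligation.
  intros; cbn. rewrite fmap2_cmpr, <- (fmap_id G) at 1. rewrite !cmp_assoc.
  rewrite <- (cmp_assoc (mmu G (F x) (F munit))), mmu_nat.
  rewrite <- !cmp_assoc, <- !fmap_cmp, mmu_runit. apply mmu_runit.
Qed.

Program Definition mon_nt_id (V W : MonoidalCategory) (F : MonoidalFunctor V W) :
    MonoidalNatTrans F F :=
  {| mnt := nt_id F |}.
Next Obligation. intros; cbn; now rewrite fmap2_id, cmp_idl, cmp_idr. Qed.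
Next Obligation. intros; cbn; now rewrite cmp_idl. Qed.

Program Definition mon_nt_vcomp (V W : MonoidalCategory) (F G H : MonoidalFunctor V W)
    (b : MonoidalNatTrans G H) (a : MonoidalNatTrans F G) : MonoidalNatTrans F H :=
  {| mnt := nt_vcomp b a |}.
Next Obligation.
  intros; cbn. now rewrite fmap2_cmp, <- cmp_assoc, mnt_mu, cmp_assoc, mnt_mu, cmp_assoc.
Qed.
Next Obligation. intros; cbn. now rewrite cmp_assoc, !mnt_eps. Qed.

Program Definition mon_nt_hcomp (U V W : MonoidalCategory)
    (F G : MonoidalFunctor U V) (H K : MonoidalFunctor V W)
    (b : MonoidalNatTrans H K) (a : MonoidalNatTrans F G) :
    MonoidalNatTrans (mon_functor_comp H F) (mon_functor_comp K G) :=
  {| mnt := nt_hcomp b a |}.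
Next Obligation.
  intros; cbn. rewrite fmap2_cmp, !cmp_assoc.
  rewrite <- (cmp_assoc (mmu K (G x) (G y))), mmu_nat.
  rewrite <- !cmp_assoc, <- !fmap_cmp, mnt_mu, !fmap_cmp, !cmp_assoc. f_equal.
  rewrite mnt_mu, <- !cmp_assoc. now rewrite nt_nat.
Qed.
Next Obligation.
  intros; cbn. rewrite cmp_assoc, <- (cmp_assoc (b (F munit))), nt_nat.
  rewrite cmp_assoc, <- cmp_assoc, <- fmap_cmp. now rewrite !mnt_eps.
Qed.

Program Definition mon_hom_cat (V W : MonoidalCategory) : Category :=
  {| obj := MonoidalFunctor V W;
     hom := @MonoidalNatTrans V W;
     idm := @mon_nt_id V W;
     cmp := @mon_nt_vcomp V W |}.
Next Obligation. intros; apply mon_nattrans_eq; intro; apply cmp_idl. Qed.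
Next Obligation. intros; apply mon_nattrans_eq; intro; apply cmp_idr. Qed.
Next Obligation. intros; apply mon_nattrans_eq; intro; apply cmp_assoc. Qed.

Program Definition mon_comp1 (U V W : MonoidalCategory) :
    Functor (prod_cat (mon_hom_cat V W) (mon_hom_cat U V)) (mon_hom_cat U W) :=
  {| fob := fun GF => mon_functor_comp (fst GF) (snd GF);
     fmap := fun _ _ ba => mon_nt_hcomp (fst ba) (snd ba) |}.
Next Obligation.
  intros U V W [G F]; apply mon_nattrans_eq; intro; cbn.
  now rewrite fmap_id, cmp_idl.
Qed.
Next Obligation.
  intros U V W [F F'] [G G'] [H H'] [b b'] [a a']; apply mon_nattrans_eq; intro; cbn in *.
  rewrite fmap_cmp, !cmp_assoc. f_equal. rewrite <- !cmp_assoc. now rewrite nt_nat.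
Qed.

Lemma mon_arr_eq (V W : MonoidalCategory) (F G F' G' : mon_hom_cat V W)
    (a : hom F G) (a' : hom F' G') :
  F = F' -> G = G' ->
  (forall x, JMeq (nt (mnt a) x) (nt (mnt a') x)) -> arr a = arr a'.
Proof.
  intros <- <- H. f_equal. apply mon_nattrans_eq.
  intro x; apply JMeq_eq, H.
Qed.

Lemma JMeq_of_eq (A : Type) (x y : A) : x = y -> JMeq x y.
Proof. now intros <-. Qed.

Lemma mon_comp_idl (U V : MonoidalCategory) (F : MonoidalFunctor U V) :
  mon_functor_comp (mon_functor_id V) F = F.
Proof.
  apply mon_functor_eq.
  - now apply functor_eq.
  - intros; apply JMeq_of_eq; cbn. apply cmp_idr.
  - apply JMeq_of_eq; cbn. apply cmp_idr.
Qed.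

Lemma mon_comp_idr (U V : MonoidalCategory) (F : MonoidalFunctor U V) :
  mon_functor_comp F (mon_functor_id U) = F.
Proof.
  apply mon_functor_eq.
  - now apply functor_eq.
  - intros; apply JMeq_of_eq; cbn. now rewrite fmap_id, cmp_idl.
  - apply JMeq_of_eq; cbn. now rewrite fmap_id, cmp_idl.
Qed.

Lemma mon_comp_assoc (T U V W : MonoidalCategory) (H : MonoidalFunctor V W)
    (G : MonoidalFunctor U V) (F : MonoidalFunctor T U) :
  mon_functor_comp (mon_functor_comp H G) F = mon_functor_comp H (mon_functor_comp G F).
Proof.
  apply mon_functor_eq.
  - now apply functor_eq.
  - intros; apply JMeq_of_eq; cbn. now rewrite fmap_cmp, cmp_assoc.
  - apply JMeq_of_eq; cbn. now rewrite fmap_cmp, cmp_assoc.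
Qed.

Program Definition MonCat : TwoCategory :=
  {| ob0 := MonoidalCategory;
     hcat := mon_hom_cat;
     id1 := mon_functor_id;
     comp1 := mon_comp1 |}.
Next Obligation.
  intros; apply functor_eq; intros; cbn.
  apply mon_arr_eq; try apply mon_comp_idl.
  intros; apply JMeq_of_eq; cbn. apply cmp_idr.
Qed.
Next Obligation.
  intros; apply functor_eq; intros; cbn.
  apply mon_arr_eq; try apply mon_comp_idr.
  intros; apply JMeq_of_eq; cbn. now rewrite fmap_id, cmp_idl.
Qed.
Next Obligation.
  intros; apply functor_eq; intros; cbn.
  apply mon_arr_eq; try apply mon_comp_assoc.
  intros; apply JMeq_of_eq; cbn. now rewrite fmap_cmp, cmp_assoc.
Qed.

Lemma lax_over_eq (A B : Bicategory) (F0 : A -> B) (F G : LaxFunctorOver F0) :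
  lfun F = lfun G ->
  (forall X Y Z (g : bhom Y Z) (f : bhom X Y), JMeq (lphi F g f) (lphi G g f)) ->
  (forall X, JMeq (lphi0 F X) (lphi0 G X)) -> F = G.
Proof.
  destruct F as [F m e ? ? ? ?], G as [G m' e' ? ? ? ?]; cbn.
  intros <- Hm He.
  assert (m = m') as <-.
  { extensionality X; extensionality Y; extensionality Z.
    extensionality g; extensionality f; apply JMeq_eq, Hm. }
  assert (e = e') as <- by (extensionality X; apply JMeq_eq, He).
  f_equal; apply proof_irrelevance.
Qed.

Lemma icon_over_eq (A B : Bicategory) (F0 : A -> B) (F G : LaxFunctorOver F0)
    (a b : IconOver F G) :
  (forall X Y (f : bhom X Y), icell a X Y f = icell b X Y f) -> a = b.
Proof.
  destruct a as [a ? ?], b as [b ? ?]; cbn; intros H.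
  assert (a = b) as <-.
  { extensionality X; extensionality Y; apply nattrans_eq, H. }
  f_equal; apply proof_irrelevance.
Qed.

Program Definition lax_over_id (A : Bicategory) : LaxFunctorOver (fun X : A => X) :=
  {| lfun := fun X Y => functor_id (bhom X Y);
     lphi := fun X Y Z g f => idm (g ⊙ f);
     lphi0 := fun X => idm (bid X) |}.
Next Obligation. intros; cbn; now rewrite cmp_idl, cmp_idr. Qed.
Next Obligation. intros; cbn; now rewrite !fmap2_id, !cmp_idr, !cmp_idl. Qed.
Next Obligation. intros; cbn; now rewrite !fmap2_id, !cmp_idr. Qed.
Next Obligation. intros; cbn; now rewrite !fmap2_id, !cmp_idr. Qed.

Program Definition lax_over_comp (A B C : Bicategory) (G0 : B -> C) (F0 : A -> B)
    (G : LaxFunctorOver G0) (F : LaxFunctorOver F0) :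
    LaxFunctorOver (fun X => G0 (F0 X)) :=
  {| lfun := fun X Y => functor_comp (lfun G (F0 X) (F0 Y)) (lfun F X Y);
     lphi := fun X Y Z g f =>
       fmap (lfun G _ _) (lphi F g f) ∘ lphi G (lfun F Y Z g) (lfun F X Y f);
     lphi0 := fun X => fmap (lfun G _ _) (lphi0 F X) ∘ lphi0 G (F0 X) |}.
Next Obligation.
  intros; cbn. rewrite cmp_assoc, lphi_nat, <- !cmp_assoc, <- !fmap_cmp.
  now rewrite lphi_nat.
Qed.
Next Obligation.
  intros; cbn. rewrite fmap2_cmpl, fmap2_cmpr.
  rewrite <- (fmap_id (lfun G _ _)), !cmp_assoc.
  rewrite <- (cmp_assoc (lphi G (lfun F _ _ (h ⊙ g)) (lfun F _ _ f))), lphi_nat.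
  rewrite <- !cmp_assoc, <- !fmap_cmp, lphi_assoc, !fmap_cmp, !cmp_assoc.
  rewrite <- (cmp_assoc (lphi G (lfun F _ _ h) (lfun F _ _ (g ⊙ f)))).
  rewrite <- (fmap_id (lfun G _ _) (lfun F _ _ h)), lphi_nat, !cmp_assoc.
  rewrite !fmap_id.
  rewrite <- (cmp_assoc (lphi G (lfun F _ _ h) (lfun F _ _ g ⊙ lfun F _ _ f))), <- lphi_assoc.
  now rewrite !cmp_assoc.
Qed.
Next Obligation.
  intros; cbn. rewrite fmap2_cmpl, <- (fmap_id (lfun G _ _)) at 1. rewrite !cmp_assoc.
  rewrite <- (cmp_assoc (lphi G (lfun F _ _ (bid Y)) (lfun F _ _ f))), lphi_nat.
  rewrite <- !cmp_assoc, <- !fmap_cmp, lphi_lunit. apply lphi_lunit.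
Qed.
Next Obligation.
  intros; cbn. rewrite fmap2_cmpr, <- (fmap_id (lfun G _ _)) at 1. rewrite !cmp_assoc.
  rewrite <- (cmp_assoc (lphi G (lfun F _ _ f) (lfun F _ _ (bid X)))), lphi_nat.
  rewrite <- !cmp_assoc, <- !fmap_cmp, lphi_runit. apply lphi_runit.
Qed.

Program Definition icon_over_id (A B : Bicategory) (F0 : A -> B) (F : LaxFunctorOver F0) :
    IconOver F F :=
  {| icell := fun X Y => nt_id (lfun F X Y) |}.
Next Obligation. intros; cbn; now rewrite fmap2_id, cmp_idl, cmp_idr. Qed.
Next Obligation. intros; cbn; now rewrite cmp_idl. Qed.

Program Definition icon_over_vcomp (A B : Bicategory) (F0 : A -> B)
    (F G H : LaxFunctorOver F0) (b : IconOver G H) (a : IconOver F G) : IconOver F H :=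
  {| icell := fun X Y => nt_vcomp (icell b X Y) (icell a X Y) |}.
Next Obligation.
  intros; cbn.
  now rewrite fmap2_cmp, <- cmp_assoc, icell_phi, cmp_assoc, icell_phi, cmp_assoc.
Qed.
Next Obligation. intros; cbn. now rewrite cmp_assoc, !icell_phi0. Qed.

Program Definition icon_over_hcomp (A B C : Bicategory) (H0 : B -> C) (F0 : A -> B)
    (F G : LaxFunctorOver F0) (H K : LaxFunctorOver H0)
    (b : IconOver H K) (a : IconOver F G) :
    IconOver (lax_over_comp H F) (lax_over_comp K G) :=
  {| icell := fun X Y => nt_hcomp (icell b (F0 X) (F0 Y)) (icell a X Y) |}.
Next Obligation.
  intros; cbn. rewrite fmap2_cmp, !cmp_assoc.
  rewrite <- (cmp_assoc (lphi K (lfun G _ _ g) (lfun G _ _ f))), lphi_nat.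
  rewrite <- !cmp_assoc, <- !fmap_cmp, icell_phi, !fmap_cmp, !cmp_assoc. f_equal.
  rewrite icell_phi, <- !cmp_assoc. now rewrite nt_nat.
Qed.
Next Obligation.
  intros; cbn.
  rewrite cmp_assoc, <- (cmp_assoc (icell b _ _ (lfun F _ _ (bid X)))), nt_nat.
  rewrite cmp_assoc, <- cmp_assoc, <- fmap_cmp. now rewrite !icell_phi0.
Qed.

Definition lax_id (A : Bicategory) : LaxFunctor A A :=
  {| lob := fun X => X; lax := lax_over_id A |}.

Definition lax_comp (A B C : Bicategory) (G : LaxFunctor B C) (F : LaxFunctor A B) :
    LaxFunctor A C :=
  {| lob := fun X => lob G (lob F X); lax := lax_over_comp G F |}.

Definition icon_of_over (A B : Bicategory) (F0 : A -> B) (F G : LaxFunctorOver F0)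
    (a : IconOver F G) :
    Icon {| lob := F0; lax := F |} {| lob := F0; lax := G |} :=
  @Build_Icon A B {| lob := F0; lax := F |} {| lob := F0; lax := G |} eq_refl a.

(** Every icon is of the form [icon_of_over a], after eliminating the equality of
    object parts; the operations on icons are defined by this elimination. *)
Definition icon_case (A B : Bicategory) (P : forall F G : LaxFunctor A B, Icon F G -> Type)
    (p : forall F0 (F G : LaxFunctorOver F0) (a : IconOver F G),
      P _ _ (icon_of_over a)) :
    forall F G (a : Icon F G), P F G a.
Proof.
  intros [F0 F] [G0 G] [e a]; cbn in e, a.
  destruct e. exact (p F0 F G a).
Defined.

Definition icon_id (A B : Bicategory) (F : LaxFunctor A B) : Icon F F :=
  @Build_Icon A B F F eq_refl (icon_over_id F).

Definition icon_vcomp (A B : Bicategory) (F G H : LaxFunctor A B)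
    (b : Icon G H) (a : Icon F G) : Icon F H :=
  icon_case (P := fun F G _ => forall H, Icon G H -> Icon F H)
    (fun F0 F G a H b =>
       @Build_Icon A B {| lob := F0; lax := F |} H
         (icon_ob b) (icon_over_vcomp (icon_over b) a))
    a H b.

Definition icon_hcomp (A B C : Bicategory) (F G : LaxFunctor A B) (H K : LaxFunctor B C)
    (b : Icon H K) (a : Icon F G) : Icon (lax_comp H F) (lax_comp K G) :=
  icon_case (P := fun H K _ => Icon (lax_comp H F) (lax_comp K G))
    (fun H0 H K b =>
       icon_case
         (P := fun F G _ => Icon (lax_comp {| lob := H0; lax := H |} F)
                                 (lax_comp {| lob := H0; lax := K |} G))
         (fun F0 F G a => icon_of_over (icon_over_hcomp b a)) a)
    b.

Ltac destruct_icons :=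
  repeat match goal with
    | a : Icon ?F ?G |- _ => destruct a as [? a]
    end;
  repeat match goal with F : LaxFunctor _ _ |- _ => destruct F as [? F] end;
  cbn in *;
  repeat match goal with e : ?x = ?y |- _ => is_var x; is_var y; destruct e end;
  cbn in *.

Lemma icon_of_over_eq (A B : Bicategory) (F0 : A -> B) (F G : LaxFunctorOver F0)
    (a b : IconOver F G) :
  (forall X Y (f : bhom X Y), icell a X Y f = icell b X Y f) ->
  @Build_Icon A B {| lob := F0; lax := F |} {| lob := F0; lax := G |} eq_refl a =
  @Build_Icon A B {| lob := F0; lax := F |} {| lob := F0; lax := G |} eq_refl b.
Proof. intros H. apply icon_over_eq in H as <-. reflexivity. Qed.

Program Definition icon_hom_cat (A B : Bicategory) : Category :=
  {| obj := LaxFunctor A B;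
     hom := @Icon A B;
     idm := @icon_id A B;
     cmp := @icon_vcomp A B |}.
Next Obligation.
  intros A B F G a; destruct_icons.
  apply icon_of_over_eq; intros; apply cmp_idl.
Qed.
Next Obligation.
  intros A B F G a; destruct_icons.
  apply icon_of_over_eq; intros; apply cmp_idr.
Qed.
Next Obligation.
  intros A B F G H K c b a; destruct_icons.
  apply icon_of_over_eq; intros; apply cmp_assoc.
Qed.

Program Definition icon_comp1 (A B C : Bicategory) :
    Functor (prod_cat (icon_hom_cat B C) (icon_hom_cat A B)) (icon_hom_cat A C) :=
  {| fob := fun GF => lax_comp (fst GF) (snd GF);
     fmap := fun _ _ ba => icon_hcomp (fst ba) (snd ba) |}.
Next Obligation.
  intros A B C [G F]; cbn in *; destruct_icons.
  apply icon_of_over_eq; intros; cbn. now rewrite fmap_id, cmp_idl.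
Qed.
Next Obligation.
  intros A B C [F F'] [G G'] [H H'] [b b'] [a a']; cbn in *; destruct_icons.
  apply icon_of_over_eq; intros; cbn.
  rewrite fmap_cmp, !cmp_assoc. f_equal. rewrite <- !cmp_assoc. now rewrite nt_nat.
Qed.

Lemma lax_over_comp_idl (A B : Bicategory) (F0 : A -> B) (F : LaxFunctorOver F0) :
  lax_over_comp (lax_over_id B) F = F.
Proof.
  apply lax_over_eq.
  - extensionality X; extensionality Y; now apply functor_eq.
  - intros; apply JMeq_of_eq; cbn. apply cmp_idr.
  - intros; apply JMeq_of_eq; cbn. apply cmp_idr.
Qed.

Lemma lax_over_comp_idr (A B : Bicategory) (F0 : A -> B) (F : LaxFunctorOver F0) :
  lax_over_comp F (lax_over_id A) = F.
Proof.
  apply lax_over_eq.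
  - extensionality X; extensionality Y; now apply functor_eq.
  - intros; apply JMeq_of_eq; cbn. now rewrite fmap_id, cmp_idl.
  - intros; apply JMeq_of_eq; cbn. now rewrite fmap_id, cmp_idl.
Qed.

Lemma lax_over_comp_assoc (A B C D : Bicategory)
    (H0 : C -> D) (G0 : B -> C) (F0 : A -> B)
    (H : LaxFunctorOver H0) (G : LaxFunctorOver G0) (F : LaxFunctorOver F0) :
  lax_over_comp (lax_over_comp H G) F = lax_over_comp H (lax_over_comp G F).
Proof.
  apply lax_over_eq.
  - extensionality X; extensionality Y; now apply functor_eq.
  - intros; apply JMeq_of_eq; cbn. now rewrite fmap_cmp, cmp_assoc.
  - intros; apply JMeq_of_eq; cbn. now rewrite fmap_cmp, cmp_assoc.
Qed.

Lemma icon_arr_eq (A B : Bicategory) (F0 : A -> B) (F G F' G' : LaxFunctorOver F0)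
    (a : IconOver F G) (a' : IconOver F' G') :
  F = F' -> G = G' ->
  (forall X Y (f : bhom X Y), JMeq (icell a X Y f) (icell a' X Y f)) ->
  @arr (icon_hom_cat A B) _ _ (icon_of_over a) =
  @arr (icon_hom_cat A B) _ _ (icon_of_over a').
Proof.
  intros <- <- H. do 2 f_equal. apply icon_over_eq.
  intros; apply JMeq_eq, H.
Qed.

Program Definition Bicat2 : TwoCategory :=
  {| ob0 := Bicategory;
     hcat := icon_hom_cat;
     id1 := lax_id;
     comp1 := icon_comp1 |}.
Next Obligation.
  intros A B; apply functor_eq; intros F G a; cbn in *; destruct_icons.
  apply icon_arr_eq; try apply lax_over_comp_idl.
  intros; apply JMeq_of_eq; cbn. apply cmp_idr.
Qed.
Next Obligation.
  intros A B; apply functor_eq; intros F G a; cbn in *; destruct_icons.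
  apply icon_arr_eq; try apply lax_over_comp_idr.
  intros; apply JMeq_of_eq; cbn. now rewrite fmap_id, cmp_idl.
Qed.
Next Obligation.
  intros A B C D; apply functor_eq; intros [[H G] F] [[H' G'] F'] [[c b] a];
    cbn in *; destruct_icons.
  apply icon_arr_eq; try apply lax_over_comp_assoc.
  intros; apply JMeq_of_eq; cbn. now rewrite fmap_cmp, cmp_assoc.
Qed.

Definition Sigma (V : MonoidalCategory) : Bicategory :=
  {| bob := unit;
     bhom := fun _ _ => V;
     bid := fun _ => munit;
     bcomp := fun _ _ _ => tensor V;
     bassoc := fun _ _ _ _ => @massoc V;
     blunit := fun _ _ => @mlunit V;
     brunit := fun _ _ => @mrunit V;
     bassoc_iso := fun _ _ _ _ => @massoc_iso V;
     blunit_iso := fun _ _ => @mlunit_iso V;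
     brunit_iso := fun _ _ => @mrunit_iso V;
     bassoc_nat := fun _ _ _ _ h h' g g' f f' => @massoc_nat V h h' g g' f f';
     blunit_nat := fun _ _ => @mlunit_nat V;
     brunit_nat := fun _ _ => @mrunit_nat V;
     bpentagon := fun _ _ _ _ _ => @mpentagon V;
     btriangle := fun _ _ _ => @mtriangle V |}.

Definition has_exactly_one_object (B : Bicategory) : Prop :=
  exists X : B, forall Y : B, Y = X.

(** The bicategory with objects [T], where [t : T] is a new name for [r t]. *)
Definition reindex (B : Bicategory) (T : Type) (r : T -> B) : Bicategory :=
  {| bob := T;
     bhom := fun s t => bhom (r s) (r t);
     bid := fun t => bid (r t);
     bcomp := fun s t u => bcomp (r s) (r t) (r u);
     bassoc := fun _ _ _ _ h g f => bassoc h g f;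
     blunit := fun _ _ f => blunit f;
     brunit := fun _ _ f => brunit f;
     bassoc_iso := fun _ _ _ _ h g f => bassoc_iso h g f;
     blunit_iso := fun _ _ f => blunit_iso f;
     brunit_iso := fun _ _ f => brunit_iso f;
     bassoc_nat := fun _ _ _ _ _ _ _ _ _ _ c b a => bassoc_nat c b a;
     blunit_nat := fun _ _ _ _ a => blunit_nat a;
     brunit_nat := fun _ _ _ _ a => brunit_nat a;
     bpentagon := fun _ _ _ _ _ k h g f => bpentagon k h g f;
     btriangle := fun _ _ _ g f => btriangle g f |}.

Definition equal_up_to_renaming_objects (B B' : Bicategory) : Prop :=
  exists r : B' -> B, Bijective r /\ reindex r = B'.

(* Main.v *)
From Stdlib Require Import FunctionalExtensionality FinFun.
Require Import Defs.

Set Implicit Arguments.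
Unset Strict Implicit.
Unset Printing Implicit Defensive.

#[local] Obligation Tactic := idtac.

(** The inverse of [Sigma] sends an object [X] of a bicategory to the monoidal
    category of its endo-1-cells.  A lax functor restricts at [X] to a monoidal
    functor between endomorphism categories, and an icon to a monoidal natural
    transformation.  When both bicategories have a single object, nothing is lost
    by restricting: the object part is unique, and every hom-category is the one
    that has been kept. *)

Lemma unit_valued_eq (T : Type) (f g : T -> unit) : f = g.
Proof. extensionality x. now destruct (f x), (g x). Qed.

Lemma bijective_from_unit (T : Type) (x : T) :
  (forall y, y = x) -> Bijective (fun _ : unit => x).
Proof.
  intros unique_x. exists (fun _ => tt). split.
  - now intros [].
  - intros y; symmetry; apply unique_x.
Qed.

Definition Sigma_lax_over (V W : MonoidalCategory) (F : MonoidalFunctor V W) :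
    @LaxFunctorOver (Sigma V) (Sigma W) (fun X => X) :=
  {| lfun := fun X Y => mfun F : Functor (@bhom (Sigma V) X Y) (@bhom (Sigma W) X Y);
     lphi := fun X Y Z => mmu F;
     lphi0 := fun X => meps F;
     lphi_nat := fun X Y Z g g' f f' b a => mmu_nat F b a;
     lphi_assoc := fun X Y Z T => mmu_assoc F;
     lphi_lunit := fun X Y => mmu_lunit F;
     lphi_runit := fun X Y => mmu_runit F |}.

Definition Sigma_lax (V W : MonoidalCategory) (F : MonoidalFunctor V W) :
    LaxFunctor (Sigma V) (Sigma W) :=
  @Build_LaxFunctor (Sigma V) (Sigma W) (fun X => X) (Sigma_lax_over F).

Definition Sigma_icon_over (V W : MonoidalCategory) (F G : MonoidalFunctor V W)
    (a : MonoidalNatTrans F G) : IconOver (Sigma_lax_over F) (Sigma_lax_over G) :=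
  @Build_IconOver (Sigma V) (Sigma W) _ (Sigma_lax_over F) (Sigma_lax_over G)
    (fun X Y => mnt a) (fun X Y Z => mnt_mu a) (fun X => mnt_eps a).

Program Definition Sigma_hom (V W : MonoidalCategory) :
    Functor (mon_hom_cat V W) (icon_hom_cat (Sigma V) (Sigma W)) :=
  {| fob := @Sigma_lax V W;
     fmap := fun F G a => icon_of_over (Sigma_icon_over a) |}.
Next Obligation. intros; now apply icon_of_over_eq. Qed.
Next Obligation. intros; now apply icon_of_over_eq. Qed.

Lemma Sigma_lax_over_id (V : MonoidalCategory) :
  Sigma_lax_over (mon_functor_id V) = lax_over_id (Sigma V).
Proof. now apply lax_over_eq. Qed.

Lemma Sigma_lax_over_comp (U V W : MonoidalCategory)
    (G : MonoidalFunctor V W) (F : MonoidalFunctor U V) :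
  Sigma_lax_over (mon_functor_comp G F) =
  lax_over_comp (Sigma_lax_over G) (Sigma_lax_over F).
Proof. now apply lax_over_eq. Qed.

Lemma Sigma_lax_id (V : MonoidalCategory) :
  Sigma_lax (mon_functor_id V) = lax_id (Sigma V).
Proof. unfold Sigma_lax, lax_id. now rewrite Sigma_lax_over_id. Qed.

Lemma Sigma_hom_comp1 (U V W : MonoidalCategory) :
  functor_comp (Sigma_hom U W) (mon_comp1 U V W) =
  functor_comp (icon_comp1 (Sigma U) (Sigma V) (Sigma W))
    (functor_prod (Sigma_hom V W) (Sigma_hom U V)).
Proof.
  apply functor_eq; intros [G F] [G' F'] [b a]; cbn in *.
  apply icon_arr_eq; [apply Sigma_lax_over_comp .. | reflexivity].
Qed.

Definition Sigma_two_functor : TwoFunctorOver (K := MonCat) (L := Bicat2) Sigma :=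
  @Build_TwoFunctorOver MonCat Bicat2 Sigma Sigma_hom Sigma_lax_id Sigma_hom_comp1.

Definition endo_moncat (B : Bicategory) (X : B) : MonoidalCategory :=
  {| mcat := bhom X X;
     tensor := bcomp X X X;
     munit := bid X;
     massoc := fun h g f => bassoc h g f;
     mlunit := fun f => blunit f;
     mrunit := fun f => brunit f;
     massoc_iso := fun h g f => bassoc_iso h g f;
     mlunit_iso := fun f => blunit_iso f;
     mrunit_iso := fun f => brunit_iso f;
     massoc_nat := fun _ _ _ _ _ _ c b a => bassoc_nat c b a;
     mlunit_nat := fun _ _ a => blunit_nat a;
     mrunit_nat := fun _ _ a => brunit_nat a;
     mpentagon := fun k h g f => bpentagon k h g f;
     mtriangle := fun g f => btriangle g f |}.

Definition endo_mon_functor (A B : Bicategory) (F0 : A -> B) (F : LaxFunctorOver F0)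
    (X : A) : MonoidalFunctor (endo_moncat X) (endo_moncat (F0 X)) :=
  @Build_MonoidalFunctor (endo_moncat X) (endo_moncat (F0 X))
    (lfun F X X) (@lphi _ _ _ F X X X) (lphi0 F X)
    (@lphi_nat _ _ _ F X X X) (@lphi_assoc _ _ _ F X X X X)
    (@lphi_lunit _ _ _ F X X) (@lphi_runit _ _ _ F X X).

Definition endo_mon_nattrans (A B : Bicategory) (F0 : A -> B) (F G : LaxFunctorOver F0)
    (a : IconOver F G) (X : A) :
    MonoidalNatTrans (endo_mon_functor F X) (endo_mon_functor G X) :=
  @Build_MonoidalNatTrans _ _ (endo_mon_functor F X) (endo_mon_functor G X)
    (icell a X X) (@icell_phi _ _ _ _ _ a X X X) (icell_phi0 a X).

Lemma endo_Sigma (V : MonoidalCategory) (X : Sigma V) : endo_moncat X = V.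
Proof. now destruct V. Qed.

Lemma Sigma_endo (B : Bicategory) (X : B) :
  Sigma (endo_moncat X) = reindex (fun _ : unit => X).
Proof. reflexivity. Qed.

Lemma endo_mon_nattrans_id (A B : Bicategory) (F0 : A -> B) (F : LaxFunctorOver F0) (X : A) :
  endo_mon_nattrans (icon_over_id F) X = mon_nt_id (endo_mon_functor F X).
Proof. now apply mon_nattrans_eq. Qed.

Lemma endo_mon_nattrans_vcomp (A B : Bicategory) (F0 : A -> B) (F G H : LaxFunctorOver F0)
    (b : IconOver G H) (a : IconOver F G) (X : A) :
  endo_mon_nattrans (icon_over_vcomp b a) X =
  mon_nt_vcomp (endo_mon_nattrans b X) (endo_mon_nattrans a X).
Proof. now apply mon_nattrans_eq. Qed.

(** All objects of [Sigma W] have the same endomorphism category, so restricting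
    at [X] lands in a fixed hom-category although [lob F X] varies with [F]. *)
Definition endo_lax (A : Bicategory) (X : A) (W : MonoidalCategory)
    (F : LaxFunctor A (Sigma W)) :
    MonoidalFunctor (endo_moncat X) (endo_moncat (tt : Sigma W)) :=
  endo_mon_functor F X.

Definition endo_icon (A : Bicategory) (X : A) (W : MonoidalCategory)
    (F G : LaxFunctor A (Sigma W)) (a : Icon F G) :
    MonoidalNatTrans (endo_lax X F) (endo_lax X G) :=
  icon_case (P := fun F G _ => MonoidalNatTrans (endo_lax X F) (endo_lax X G))
    (fun F0 F G a => endo_mon_nattrans a X) a.

Program Definition endo_hom (A : Bicategory) (X : A) (W : MonoidalCategory) :
    Functor (icon_hom_cat A (Sigma W))
      (mon_hom_cat (endo_moncat X) (endo_moncat (tt : Sigma W))) :=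
  {| fob := @endo_lax A X W;
     fmap := @endo_icon A X W |}.
Next Obligation. intros A X W [F0 F]. exact (endo_mon_nattrans_id F X). Qed.
Next Obligation.
  intros A X W F G H b a; cbn in F, G, H, b, a; destruct_icons.
  exact (endo_mon_nattrans_vcomp b a X).
Qed.

Section HomIsomorphism.

Variables V W : MonoidalCategory.

(** [V'] is equal to [V], but not convertible to it; [Sigma V'] is convertible to
    [Sigma V].  Hence [endo_hom] takes values in [mon_hom_cat V' W'], and the
    isomorphism is transported along [endo_Sigma] only at the end. *)
Local Notation V' := (endo_moncat (tt : Sigma V)).
Local Notation W' := (endo_moncat (tt : Sigma W)).

Lemma endo_Sigma_lax (F : MonoidalFunctor V' W') :
  endo_lax (tt : Sigma V) (Sigma_lax F) = F.
Proof. now apply mon_functor_eq. Qed.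

Lemma Sigma_endo_lax_over (F : @LaxFunctorOver (Sigma V) (Sigma W) (fun X => X)) :
  Sigma_lax_over (endo_mon_functor F tt) = F.
Proof.
  apply lax_over_eq.
  - now extensionality X; extensionality Y; destruct X, Y.
  - now intros [] [] [].
  - now intros [].
Qed.

Lemma endo_hom_Sigma_hom :
  functor_comp (endo_hom (tt : Sigma V) W) (Sigma_hom V' W') = functor_id (mon_hom_cat V' W').
Proof.
  apply functor_eq; intros F G a.
  apply mon_arr_eq; [apply endo_Sigma_lax .. | reflexivity].
Qed.

Lemma Sigma_hom_endo_hom :
  functor_comp (Sigma_hom V' W') (endo_hom (tt : Sigma V) W) =
  functor_id (icon_hom_cat (Sigma V) (Sigma W)).
Proof.
  apply functor_eq. refine (icon_case _). intros F0 F G a.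
  destruct (unit_valued_eq (fun X => X) F0).
  apply icon_arr_eq; [apply Sigma_endo_lax_over .. | now intros [] []].
Qed.

Lemma Sigma_hom_isomorphism : is_isomorphism_of_categories (Sigma_hom V W).
Proof.
  rewrite <- (endo_Sigma (tt : Sigma V)), <- (endo_Sigma (tt : Sigma W)).
  exists (endo_hom (tt : Sigma V) W). split.
  - exact endo_hom_Sigma_hom.
  - exact Sigma_hom_endo_hom.
Qed.

End HomIsomorphism.

Lemma Sigma_has_exactly_one_object (V : MonoidalCategory) :
  has_exactly_one_object (Sigma V).
Proof. exists tt. now intros []. Qed.

Lemma one_object_equal_Sigma_endo (B : Bicategory) (X : B) :
  (forall Y : B, Y = X) -> equal_up_to_renaming_objects B (Sigma (endo_moncat X)).
Proof.
  intros unique_X. exists (fun _ => X). split.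
  - now apply bijective_from_unit.
  - symmetry. apply Sigma_endo.
Qed.

Theorem theorem4p1 :
  (exists S : TwoFunctorOver (K := MonCat) (L := Bicat2) Sigma,
     forall V W : MonoidalCategory,
       is_isomorphism_of_categories (tf_hom S V W)) /\
  (forall V : MonoidalCategory, has_exactly_one_object (Sigma V)) /\
  (forall B : Bicategory, has_exactly_one_object B ->
     exists V : MonoidalCategory, equal_up_to_renaming_objects B (Sigma V)).
Proof.
  split; [| split].
  - exists Sigma_two_functor. exact Sigma_hom_isomorphism.
  - exact Sigma_has_exactly_one_object.
  - intros B [X unique_X]. exists (endo_moncat X).
    now apply one_object_equal_Sigma_endo.
Qed.
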